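(* Suppose that $X$ is a Hausdorff space, $E$ is a co-analytic equivalence relation on $X$, and $R$ is a reflexive $G_\delta$ binary relation on $X$ for which there is an $R$-clique $Y\subseteq X$ intersecting uncountably many $E$-classes. Then there is a Cantor set $C\subseteq X$ that is both a partial transversal of $E$ and an $R$-clique.
   Context: A topological space is analytic if it is a continuous image of a closed subset of $\mathbb{N}^{\mathbb{N}}$ (where $\mathbb{N}$ is discrete and $\mathbb{N}^{\mathbb{N}}$ has the product topology). A subset of a topological space is co-analytic if its complement is analytic (as a subspace), and $G_\delta$ if it is a countable intersection of open sets; binary relations on $X$ are viewed as subsets of the space $X\times X$. A set $Y\subseteq X$ is an $R$-clique if $x\mathrel{R}y$ for all distinct $x,y\in Y$. A partial transversal of an equivalence relation $E$ on $X$ is a set $Y\subseteq X$ that does not contain distinct $E$-related points. A Cantor set is a homeomorphic copy of the Cantor space $2^{\mathbb{N}}$. *)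

(* Defs.v *)
From Stdlib Require Export RelationClasses.
From mathcomp Require Export all_boot all_order all_algebra.
From mathcomp Require Export all_classical all_reals all_analysis borel_hierarchy.

Set Implicit Arguments.
Unset Strict Implicit.
Unset Printing Implicit Defensive.

Local Open Scope classical_set_scope.

(* A set coerces to its subtype [set_type], which carries the subspace
   topology. As [f] below is defined only on [F], the empty space is analytic
   (take [F] empty). [nat] carries the discrete topology. *)
Definition analytic_space (T : topologicalType) : Prop :=
  exists (F : set (prod_topology (fun _ : nat => nat))) (f : F -> T),
    [/\ closed F, continuous f & range f = [set: T]].

Definition analytic (T : topologicalType) (A : set T) : Prop :=
  analytic_space (set_type A).

Definition co_analytic (T : topologicalType) (A : set T) : Prop :=
  analytic (~` A).

Definition homeomorphic (S T : topologicalType) : Prop :=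
  exists (f : S -> T) (g : T -> S),
    [/\ cancel f g, cancel g f, continuous f & continuous g].

Definition Cantor_set (T : topologicalType) (C : set T) : Prop :=
  homeomorphic cantor_space (set_type C).

Definition rel_set (T : Type) (R : T -> T -> Prop) : set (T * T) :=
  [set p | R p.1 p.2].

Definition clique (T : Type) (R : T -> T -> Prop) (Y : set T) : Prop :=
  forall x y, Y x -> Y y -> x <> y -> R x y.

Definition partial_transversal (T : Type) (E : T -> T -> Prop) (Y : set T) :
    Prop :=
  forall x y, Y x -> Y y -> x <> y -> ~ E x y.

Definition eq_classes (T : Type) (E : T -> T -> Prop) : set (set T) :=
  range (fun x => [set y | E x y]).

Definition classes_meeting (T : Type) (E : T -> T -> Prop) (Y : set T) :
    set (set T) :=
  [set D | eq_classes E D /\ D `&` Y !=set0].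

(* Main.v *)
Require Import Defs.

Local Open Scope classical_set_scope.

(* The complement of [E] is the image of a closed [F] of the Baire space under
   a continuous [phi], so that [c] in [F] witnesses that the two components of
   [phi c] are inequivalent.

   Consider configurations: families of [2^n] points of the clique [Y], indexed
   by binary words. A set of configurations is negligible if countably many
   classes together meet each of its members. This is a sigma-ideal, and pairs
   of configurations without equivalent entries, taken from a non-negligible
   set, form a non-negligible set. Doubling, and then shrinking so as to fix
   initial segments of codes of points and of witnesses for the pairs of words
   that differ in one bit, yields in the limit a continuous
   [f : 2^N -> X] whose values are pairwise [R]-related (by reflexivity near the
   diagonal) and such that [f x], [f y] are inequivalent if [x] and [y] differ
   in exactly one bit.

   By transitivity of [E] and the Baire category theorem, the pairs [(x, y)]
   with [f x], [f y] inequivalent are then non-meager in every open set. They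
   are a countable union over the initial segments of the witnesses, so one can
   build a Cantor scheme in [2^N] in which, for each pair of distinct nodes, the
   pairs with a witness through a prescribed initial segment are non-meager
   everywhere in the product of the two nodes. Its branches have pairwise
   inequivalent images. *)

(** * Baire category in spaces of sequences *)

Section Agreement.
Context {A : Type}.
Implicit Types x y z : nat -> A.

Definition agree n x y := forall k, k < n -> x k = y k.

Lemma agree_refl n x : agree n x x. Proof. by []. Qed.

Lemma agree_sym {n x y} : agree n x y -> agree n y x.
Proof. by move=> xy k /xy. Qed.

Lemma agree_trans {n x y z} : agree n x y -> agree n y z -> agree n x z.
Proof. by move=> xy yz k kn; rewrite xy // yz. Qed.

Lemma agree_le {m n x y} : m <= n -> agree n x y -> agree m x y.
Proof. by move=> mn xy k km; apply: xy; exact: leq_trans mn. Qed.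

Lemma agree_mkseq n x y : agree n x y <-> mkseq x n = mkseq y n.
Proof.
split=> [xy|xy k kn].
  by apply/eq_in_map => k; rewrite mem_iota => /xy.
by move/(congr1 (nth (x k) ^~ k)): xy; rewrite !nth_mkseq.
Qed.

(** The diagonal limit: term [j] is read off [x j.+1], where it is already settled since
    [j < l j.+1]. *)
Lemma agree_lim (l : nat -> nat) (x : nat -> nat -> A) :
  (forall k, k <= l k) -> (forall k, l k <= l k.+1) ->
  (forall k, agree (l k) (x k) (x k.+1)) ->
  exists z, forall k, agree (l k) z (x k).
Proof.
move=> kl ll xx.
have l_le k m : k <= m -> l k <= l m.
  by elim: m => [|m IH]; rewrite leq_eqVlt => /predU1P[->//|//];
    rewrite ltnS => /IH /leq_trans; apply.
have xle k m : k <= m -> agree (l k) (x k) (x m).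
  elim: m => [|m IH]; rewrite leq_eqVlt => /predU1P[->//|//];
    rewrite ltnS => km.
  by apply: agree_trans (IH km) _; apply: agree_le (xx m); exact: l_le.
exists (fun j => x j.+1 j) => k j jk.
have [/xle|/ltnW/xle] := leqP k j.+1; first by move=> /(_ _ jk).
by move=> ->//; exact: leq_trans (kl _).
Qed.

End Agreement.

Lemma dependent_sequence (T : Type) (I : nat -> T -> Prop)
    (S : nat -> T -> T -> Prop) (t0 : T) :
  I 0 t0 -> (forall n t, I n t -> exists t', I n.+1 t' /\ S n t t') ->
  exists u : nat -> T, u 0 = t0 /\ forall n, I n (u n) /\ S n (u n) (u n.+1).
Proof.
move=> It0 step.
(* Moving the invariant under the existential makes the step total, so that [choice] applies. *)
have {}step n t : exists t', I n t -> I n.+1 t' /\ S n t t'.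
  have [/step[t' t'P]|nI] := pselect (I n t); first by exists t'.
  by exists t => /nI.
have [g gP] := choice (fun p : nat * T => step p.1 p.2).
pose u := fix u n := if n is m.+1 then g (m, u m) else t0.
have Iu n : I n (u n) by elim: n => [//|n IH]; have [] := gP (n, u n) IH.
by exists u; split=> // n; split=> //; have [] := gP (n, u n) (Iu n).
Qed.

Section Meager.
Context {A : countType}.
Implicit Types (x y z : nat -> A) (P D : set (nat -> A)).

Definition cylinder n x : set (nat -> A) := [set y | agree n x y].

(** Open dense sets of a power of the discrete space [A], stated through basic cylinders. *)
Definition open_dense D :=
  (forall x, D x -> exists n, cylinder n x `<=` D) /\
  forall n x, cylinder n x `&` D !=set0.

Definition meager P :=
  exists D_ : nat -> set (nat -> A),
    (forall k, open_dense (D_ k)) /\ P `<=` ~` \bigcap_k D_ k.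

Lemma open_denseT : open_dense setT.
Proof.
by split=> [x _|n x]; [exists 0 | exists x; split].
Qed.

Lemma sub_meager P P' : P `<=` P' -> meager P' -> meager P.
Proof. by move=> PP' [D [oD P'D]]; exists D; split=> // x /PP'/P'D. Qed.

Lemma meager0 : meager set0.
Proof. by exists (fun=> setT); split=> [k|//]; exact: open_denseT. Qed.

Lemma open_denseC_meager D : open_dense D -> meager (~` D).
Proof.
by move=> oD; exists (fun=> D); split=> // x nDx /(_ 0 I).
Qed.

Lemma bigcup_meager (J : countType) (P_ : J -> set (nat -> A)) :
  (forall i, meager (P_ i)) -> meager (\bigcup_i P_ i).
Proof.
move=> /choice[D DP].
(* The doubly indexed open dense sets are enumerated by codes of pairs; [setT] fills the numbers
   that code no pair. *)
exists (fun n => if unpickle n is Some (i, k) then D i k else setT); split.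
  move=> n; case: unpickle => [[i k]|]; last exact: open_denseT.
  exact: (DP i).1.
move=> x [i _ Pix] Dx; apply: ((DP i).2 x Pix) => k _.
by have := Dx (pickle (i, k)) I; rewrite pickleK.
Qed.

Lemma setU_meager P P' : meager P -> meager P' -> meager (P `|` P').
Proof.
move=> mP mP'; rewrite -bigcup2E.
apply: (@sub_meager _ (\bigcup_(b : bool) if b then P else P')).
  by move=> x [[|[|i]] _] //= ?; [exists true|exists false].
by apply: bigcup_meager => -[].
Qed.

Lemma Baire_cylinder P n x : meager P -> exists2 y, agree n x y & ~ P y.
Proof.
move=> [D [oD PD]].
pose S k (p q : nat * (nat -> A)) :=
  [/\ p.1 <= q.1, agree p.1 p.2 q.2 & cylinder q.1 q.2 `<=` D k].
have [||u [u0 uP]] :=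
    @dependent_sequence _ (fun k p => k <= p.1) S (n, x); first by [].
  move=> k [m y] /= km; have [Do Dd] := oD k.
  have [z [yz /Do[l zl]]] := Dd m y.
  (* Besides [l], which enters [D k], the length grows strictly, so that the cylinders shrink to a
     point. *)
  exists (maxn m.+1 l, z); rewrite /= leq_max ltnS km; split=> //; split=> //=.
    by rewrite leq_max leqnSn.
  by move=> w zw; apply: zl; apply: agree_le zw; rewrite leq_maxr.
have [z zP] : exists z, forall k, agree (u k).1 z (u k).2.
  by apply: agree_lim => k; have [? [? ? ?]] := uP k.
exists z; first by have := agree_sym (zP 0); rewrite u0.
move=> /PD; apply=> k _; have [_ [_ _]] := uP k; apply.
exact/agree_sym.
Qed.

(** [P] is nowhere meager in the cylinder. Unlike mere non-meagerness, this passes to smaller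
    cylinders. *)
Definition heavy P n x :=
  forall m y, n <= m -> agree n x y -> ~ meager (P `&` cylinder m y).

Lemma heavy_le P n x m y : n <= m -> agree n x y -> heavy P n x -> heavy P m y.
Proof.
move=> nm xy hP k z mk yz; apply: hP; first exact: leq_trans mk.
by apply: agree_trans xy _; exact: agree_le yz.
Qed.

Lemma sub_heavy P P' n x : P `<=` P' -> heavy P n x -> heavy P' n x.
Proof.
move=> PP' hP m y nm xy mP'; apply: (hP m y nm xy).
by apply: sub_meager mP' => z [/PP' ? ?].
Qed.

Lemma heavy_neq0 P n x : heavy P n x -> exists2 y, agree n x y & P y.
Proof.
move=> /(_ n x (leqnn _) (agree_refl _ _)) nm; apply: contrapT => nP.
apply: nm; apply: sub_meager meager0 => y [Py xy]; apply: nP.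
by exists y.
Qed.

(* This is the Banach category theorem: if every piece [P_ i] were meager in
   cylinders dense below [x], then [P] would be covered by countably many
   meager sets, there being only countably many cylinders. *)
Lemma heavy_bigcup (J : countType) P (P_ : J -> set (nat -> A)) n x :
  heavy P n x -> P `<=` \bigcup_i P_ i ->
  exists i m y, [/\ n <= m, agree n x y & heavy (P_ i) m y].
Proof.
move=> hP PP; apply: contrapT => nh.
have light i m y : n <= m -> agree n x y ->
    exists m' y', [/\ m <= m', agree m y y' & meager (P_ i `&` cylinder m' y')].
  move=> nm xy; apply: contrapT => nl; apply: nh; exists i, m, y; split=> //.
  by move=> m' y' mm' yy' mP; apply: nl; exists m', y'.
pose cyl (s : seq A) : set (nat -> A) := [set y | mkseq y (size s) = s].
have cylE m y : cyl (mkseq y m) = cylinder m y.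
  by apply/seteqP; split=> z; rewrite /cyl /= size_mkseq;
    [move=> /esym/agree_mkseq | move=> /agree_mkseq/esym].
(* [G i] will be open and dense, by [light]. A point of [P_ i] in the cylinder lies outside [G i] or
   in one of the countably many meager pieces [M i s]. *)
pose G i : set (nat -> A) :=
  [set y | cylinder n x y -> exists2 s, cyl s y & meager (P_ i `&` cyl s)].
pose M i (s : seq A) : set (nat -> A) :=
  [set y | meager (P_ i `&` cyl s) /\ (P_ i `&` cyl s) y].
apply: (hP n x (leqnn _) (agree_refl _ _)).
apply: (@sub_meager _ (\bigcup_i (~` G i `|` \bigcup_s M i s))).
  move=> y [/PP[i _ Piy] xy]; exists i => //.
  have [Gy|nG] := pselect (G i y); last by left.
  by right; have [//|s sy ms] := Gy; exists s.
apply: bigcup_meager => i; apply: setU_meager; last first.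
  apply: bigcup_meager => s.
  have [ms|nms] := pselect (meager (P_ i `&` cyl s)).
    by apply: sub_meager ms => y [].
  by apply: sub_meager meager0 => y [].
apply: open_denseC_meager; split=> [y Gy|m y].
  have [xy|nxy] := pselect (cylinder n x y).
    have [s sy ms] := Gy xy; exists (size s) => z /agree_mkseq yz _.
    by exists s => //; rewrite /cyl /= -yz.
  exists n => z yz xz; exfalso; apply: nxy; apply: agree_trans xz _.
  exact: agree_sym.
have [nxy|xy] := pselect (~ exists2 z, agree m y z & agree n x z).
  by exists y; split=> // xy; exfalso; apply: nxy; exists y.
move: xy => /contrapT[z yz xz].
have [||m' [y' [mm' zy' my']]] := light i (maxn n m) z => //.
  by rewrite leq_maxl.
exists y'; split.
  by apply: agree_trans yz _; apply: agree_le zy'; rewrite leq_maxr.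
move=> _; exists (mkseq y' m'); rewrite cylE//.
Qed.

Definition twist (t : A -> A) m x := fun k => if k == m then t (x k) else x k.

Lemma agree_twist t m n x y : agree n x y ->
  agree n (twist t m x) (twist t m y).
Proof. by move=> xy k kn; rewrite /twist xy. Qed.

Lemma agree_twistl t m n x : n <= m -> agree n x (twist t m x).
Proof.
by move=> nm k kn; rewrite /twist ltn_eqF//; exact: leq_trans nm.
Qed.

Lemma twistK t m : involutive t -> involutive (twist t m).
Proof.
by move=> tK x; apply/funext => k; rewrite /twist; case: (k == m); rewrite ?tK.
Qed.

(** For an involution [t], [twist t m] is a homeomorphism equal to its own inverse, so preimages of
    open dense sets are open dense. *)
Lemma twist_meager t m P : involutive t ->
  meager P -> meager (twist t m @^-1` P).
Proof.
move=> tK [D [oD PD]]; exists (fun k => twist t m @^-1` D k); split; last first.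
  by move=> x /PD nD Dx; apply: nD => k _; exact: Dx.
move=> k; have [Do Dd] := oD k; split=> [x /Do[n xn]|n x].
  by exists n => y xy; apply: xn; exact: agree_twist.
have [y [xy Dy]] := Dd n (twist t m x); exists (twist t m y); split.
  by have := agree_twist t m _ _ _ xy; rewrite twistK.
by rewrite /preimage /= twistK.
Qed.

End Meager.

(** * Topology of sequence spaces and codings *)

Section Cylinders.
Context {K : discreteTopologicalType}.
Notation seqs := (prod_topology (fun _ : nat => K)).

(** Continuity of the restriction of [f] to [F], with [f] kept total to avoid subtypes. *)
Definition cylinder_continuous {A : Type} {X : topologicalType}
    (F : set (nat -> A)) (f : (nat -> A) -> X) :=
  forall x, F x -> forall V, nbhs (f x) V ->
  exists n, forall y, F y -> agree n x y -> V (f y).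

Lemma nbhs_cylinder (x : seqs) (V : set seqs) :
  nbhs x V <-> exists n, forall y, agree n x y -> V y.
Proof.
split; last first.
  move=> [n nV]; suff: nbhs x [set y : seqs | agree n x y] by apply: filterS.
  elim: n {V nV} => [|n IH]; first by apply: filterS filterT => y _ k.
  have xn : nbhs x [set y : seqs | x n = y n].
    have /(_ [set a | x n = a]) := @proj_continuous _ (fun _ : nat => K) n x.
    by apply; rewrite nbhs_principalE; apply/principal_filterP.
  apply: filterS (filterI IH xn) => y [xy xyn] k.
  by rewrite ltnS leq_eqVlt => /predU1P[->//|]; exact: xy.
(* The filter generated by the cylinders around [x] converges in each coordinate, hence in the
   product. *)
pose G : set_system seqs :=
  [set W : set seqs | exists n, forall y, agree n x y -> W y].
have FG : Filter G.
  split; first by exists 0.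
    move=> W W' [n nW] [m mW']; exists (maxn n m) => y xy; split.
      by apply: nW; apply: agree_le xy; exact: leq_maxl.
    by apply: mW'; apply: agree_le xy; exact: leq_maxr.
  by move=> W W' WW' [n nW]; exists n => y /nW/WW'.
suff : G --> x by apply.
apply/cvg_sup => i W [W' [[W'' _ <-] /= W''x] sW].
exists i.+1 => y xy; apply: sW => /=.
by move: W''x; rewrite /proj /= (xy i)//.
Qed.

End Cylinders.

Lemma co_analytic_coding {X : topologicalType} (E : X -> X -> Prop) (x0 : X) :
  co_analytic (rel_set E) ->
  exists (F : set (nat -> nat)) (phi : (nat -> nat) -> X * X),
    [/\ forall c, (forall n, exists2 b, F b & agree n c b) -> F c,
        cylinder_continuous F phi &
        forall p, ~ E p.1 p.2 <-> exists2 c, F c & phi c = p].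
Proof.
move=> [F [f [clF cf rf]]].
(* The value [(x0, x0)] is a placeholder outside [F]; every claim about [phi] is restricted to
   [F]. *)
pose phi c := if pselect (F c) is left Fc
  then val (f (exist _ c (mem_set Fc))) else (x0, x0).
have phiE c (Fc : c \in F) : phi c = val (f (exist _ c Fc)).
  rewrite /phi; case: pselect => [Fc'|nFc]; last by case: nFc; exact: set_mem.
  by congr (val (f _)); exact: eq_sig_hprop.
exists F, phi; split.
- move=> c Fc; apply: clF => B /nbhs_cylinder[n nB].
  by have [b Fb cb] := Fc n; exists b; split=> //; exact: nB.
- move=> c Fc V; rewrite (phiE c (mem_set Fc)).
  pose c' : set_type F := exist _ c (mem_set Fc); rewrite -/c' => nV.
  have cval : continuous (@set_val _ (~` rel_set E)).
    exact: initial_continuous.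
  have : nbhs c' (f @^-1` (val @^-1` V)) by apply: cf; exact: cval.
  move=> [W [[W' oW' <-] /= W'c] sW].
  have /nbhs_cylinder[n nW] : nbhs (c : prod_topology (fun _ : nat => nat)) W'.
    by apply: open_nbhs_nbhs; split.
  exists n => y Fy cy; rewrite (phiE y (mem_set Fy)).
  by apply: (sW (exist _ y (mem_set Fy))); exact: nW.
- move=> p; split=> [nEp|[c Fc <-]].
    have : [set: set_type (~` rel_set E)]
      (exist _ p (mem_set (nEp : (~` rel_set E) p))) by [].
    rewrite -rf => -[[c Fc] _ fc]; exists c; first exact: set_mem.
    by rewrite (phiE c Fc) fc.
  rewrite (phiE c (mem_set Fc)).
  exact: (set_mem (valP (f _))).
Qed.

(** A continuous injection of a compact space into a Hausdorff space is an embedding: images of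
    closed sets are compact, hence closed. *)
Lemma cylinder_continuous_Cantor_set {X : topologicalType}
    (h : (nat -> bool) -> X) :
  hausdorff_space X -> injective h -> cylinder_continuous setT h ->
  Cantor_set (range h).
Proof.
move=> hX inj_h ch.
have ch' : continuous (h : cantor_space -> X).
  move=> x V /(ch x I) [n nV].
  by apply/nbhs_cylinder; exists n => y xy; exact: nV.
pose f (x : cantor_space) : set_type (range h) :=
  exist _ (h x) (mem_set (imageT h x)).
have surj (c : set_type (range h)) : exists x, h x = val c.
  by have [x _ <-] := set_mem (valP c); exists x.
have [g gP] := choice surj.
have fK : cancel f g by move=> x; apply: inj_h; rewrite gP.
have gK : cancel g f by move=> c; apply: val_inj; rewrite /= gP.
have cf : continuous f.
  move=> x V [W [[W' oW' <-] /= W'x] sW];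
    apply: filterS (_ : nbhs x (h @^-1` W')).
    by move=> y W'y; apply: sW.
  by apply: ch'; apply: open_nbhs_nbhs.
exists f, g; split=> //.
apply/continuous_closedP => D clD.
have cpt : compact (h @` D).
  apply: continuous_compact; first exact: continuous_subspaceT.
  by apply: subclosed_compact clD cantor_space_compact _.
have -> : g @^-1` D = (@set_val _ (range h)) @^-1` (h @` D).
  apply/seteqP; split=> c /=.
    by move=> Dgc; exists (g c) => //; exact: gP.
  by move=> [x Dx xc]; suff -> : g c = x by []; apply: inj_h; rewrite gP.
apply: closed_comp; last exact: compact_closed.
by move=> c _; exact: initial_continuous.
Qed.

Lemma hausdorff_prod {X Y : topologicalType} :
  hausdorff_space X -> hausdorff_space Y -> hausdorff_space (X * Y)%type.
Proof.
move=> hX hY [x y] [x' y'] cl; congr (_, _).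
  apply: hX => A B Ax Bx'.
  have [|[u v] [Au Bu]] := cl (fst @^-1` A) (fst @^-1` B) (cvg_fst Ax).
    exact: (@cvg_fst _ _ (nbhs x') (nbhs y')).
  by exists u.
apply: hY => A B Ay By'.
have [|[u v] [Av Bv]] := cl (snd @^-1` A) (snd @^-1` B) (cvg_snd Ay).
  exact: (@cvg_snd _ _ (nbhs x') (nbhs y')).
by exists v.
Qed.

(** Points [b] of [F] near [c] have [phi b] near [phi c], and some of them have it near [p];
    separation then forces equality. This identifies the pair witnessed by a limit of witnesses. *)
Lemma coding_limit {Z : topologicalType} (F : set (nat -> nat))
    (phi : (nat -> nat) -> Z) c p :
  hausdorff_space Z ->
  (forall c, (forall n, exists2 b, F b & agree n c b) -> F c) ->
  cylinder_continuous F phi ->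
  (forall V n, nbhs p V -> exists b, [/\ F b, agree n c b & V (phi b)]) ->
  F c /\ phi c = p.
Proof.
move=> hZ clF cphi cp.
have Fc : F c.
  by apply: clF => n; have [b [? ? _]] := cp setT n filterT; exists b.
split=> //; apply: hZ => V W /(cphi _ Fc)[n nV] /cp-/(_ n)[b [Fb cb Wb]].
by exists (phi b); split=> //; exact: nV.
Qed.

(** * From an uncountable clique to a homomorphism *)

Section Configurations.
Context {X : topologicalType} (E : X -> X -> Prop).
Implicit Types (g : (nat -> bool) -> X) (A B : set ((nat -> bool) -> X)).

(* Families indexed by the binary words of length [n] are encoded as functions
   on infinite binary sequences that depend on the first [n] bits only. *)
Definition finitary {T : Type} n (g : (nat -> bool) -> T) :=
  forall x y, agree n x y -> g x = g y.

(** The sigma-ideal of negligible sets; [K] holds representatives of the countably many classes. *)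
Definition covered A :=
  exists2 K : set X, countable K &
    forall g, A g -> exists p x, K p /\ E p (g x).

Definition double {T : Type} n (g0 g1 : (nat -> bool) -> T) :=
  fun x : nat -> bool => if x n then g1 x else g0 x.

Definition doubling n A : set ((nat -> bool) -> X) :=
  [set g | exists g0 g1, [/\ A g0, A g1,
     forall x y, ~ E (g0 x) (g1 y) & g = double n g0 g1]].

Definition update k b (x : nat -> bool) := fun j => if j == k then b else x j.

Lemma sub_covered A B : A `<=` B -> covered B -> covered A.
Proof. by move=> AB [K cK BK]; exists K => // g /AB/BK. Qed.

Lemma bigcup_covered (J : countType) (A_ : J -> set ((nat -> bool) -> X)) :
  (forall i, covered (A_ i)) -> covered (\bigcup_i A_ i).
Proof.
move=> /(_ _)/cid2-/all_sig2[K cK AK].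
exists (\bigcup_i K i); first by apply: bigcup_countable.
by move=> g [i _ /AK[p [x [Kp Epx]]]]; exists p, x; split=> //; exists i.
Qed.

Lemma agree_nth n (x : nat -> bool) : agree n x (nth false (mkseq x n)).
Proof. by move=> k kn; rewrite nth_mkseq. Qed.

Lemma finitary_countable {T : Type} n (g : (nat -> bool) -> T) :
  finitary n g -> countable (range g).
Proof.
move=> fg; apply: (@sub_countable _ _ _
  ((fun s : seq bool => g (nth false s)) @` setT)).
  apply: subset_card_le => _ [x _ <-]; exists (mkseq x n) => //.
  by rewrite -(fg _ _ (agree_nth n x)).
by apply: sub_countable (card_image_le _ _) _; exact: countableP.
Qed.

Lemma finitary_bound n (Q : (nat -> bool) -> nat -> Prop) :
  (forall x y l, agree n x y -> Q x l -> Q y l) ->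
  (forall x l l', l <= l' -> Q x l -> Q x l') ->
  (forall x, exists l, Q x l) -> exists l, forall x, Q x l.
Proof.
move=> Qn Ql /choice[l lQ].
exists (\max_(s : n.-tuple bool) l (nth false s)) => x.
apply: (Qn _ _ _ (agree_sym (agree_nth n x))).
apply: Ql (lQ _).
have s : size (mkseq x n) == n by rewrite size_mkseq.
exact: (leq_bigmax (F := fun s : n.-tuple bool => l (nth false s)) (Tuple s)).
Qed.

(** Given a countable [K], pick [g0] in [A] avoiding the classes of [K], then [g1] avoiding those of
    [K] and of the countable range of [g0]. Their double avoids [K]. *)
Lemma uncovered_doubling n A :
  (forall g, A g -> finitary n g) -> ~ covered A -> ~ covered (doubling n A).
Proof.
move=> fA nA [K cK DK].
have avoid K' : countable K' ->
    exists2 g, A g & forall p x, K' p -> ~ E p (g x).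
  move=> cK'; apply: contrapT => nK'; apply: nA; exists K' => // g Ag.
  apply: contrapT => nE; apply: nK'; exists g => // p x K'p Epx.
  by apply: nE; exists p, x.
have [g0 Ag0 Kg0] := avoid K cK.
have [|g1 Ag1 Kg1] := avoid (K `|` range g0).
  rewrite -bigcup2E; apply: bigcup_countable => [|[|[|i]] _]//=.
  exact: finitary_countable (fA _ Ag0).
have [|p [x [Kp]]] := DK (double n g0 g1).
  by exists g0, g1; split=> // x y; apply: Kg1; right; exists x.
rewrite /double; case: (x n); first by apply: Kg1; left.
exact: Kg0.
Qed.

(** The finite list [h g] of the values of [q g] on words of length [n] takes countably many values,
    so one of its fibers is not negligible. *)
Lemma uncovered_fiber (T : countType) n A
    (q : ((nat -> bool) -> X) -> (nat -> bool) -> T) :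
  (forall g, A g -> finitary n (q g)) -> ~ covered A ->
  exists B, [/\ B `<=` A, ~ covered B &
    forall g g' x, B g -> B g' -> q g x = q g' x].
Proof.
move=> fq nA; apply: contrapT => nB; apply: nA.
pose h g :=
  [seq q g (nth false s) | s <- [seq val t | t <- enum {:n.-tuple bool}]].
apply: (@sub_covered _ (\bigcup_s (A `&` [set g | h g = s]))).
  by move=> g Ag; exists (h g).
apply: bigcup_covered => s; apply: contrapT => nc; apply: nB.
exists (A `&` [set g | h g = s]); split=> //.
move=> g g' x [Ag hg] [Ag' hg'].
have hh : h g = h g' by rewrite hg hg'.
rewrite (fq _ Ag _ _ (agree_nth n x)) (fq _ Ag' _ _ (agree_nth n x)).
move: hh; rewrite /h => /eq_in_map; apply.
have sx : size (mkseq x n) == n by rewrite size_mkseq.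
by apply/mapP; exists (Tuple sx); rewrite ?mem_enum.
Qed.

End Configurations.

Section Homomorphism.
Context {X : topologicalType} (E : X -> X -> Prop).
Context (F : set (nat -> nat)) (phi : (nat -> nat) -> X * X).
Context (F_closed : forall c, (forall n, exists2 b, F b & agree n c b) -> F c).
Context (phi_continuous : cylinder_continuous F phi).
Context (phi_range : forall p, ~ E p.1 p.2 <-> exists2 c, F c & phi c = p).

(* Each of the finitely many values of a configuration is allowed to move in
   the cylinder of length [l] around its code without leaving [U]. *)
Lemma finitary_code_bound n (g : (nat -> bool) -> X) (code : X -> nat -> nat)
    (U : set (X * X)) :
  (forall x, F (code x) /\ (phi (code x)).1 = x) ->
  finitary n g -> open U -> (forall x y, U (g x, g y)) ->
  exists l, n <= l /\ forall x y b b', F b -> F b' ->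
    agree l (code (g x)) b -> agree l (code (g y)) b' ->
    U ((phi b).1, (phi b').1).
Proof.
move=> codeP fg oU gU.
pose Q x y l := forall b b', F b -> F b' ->
    agree l (code (g x)) b -> agree l (code (g y)) b' ->
    U ((phi b).1, (phi b').1).
have Q_le x y l l' : l <= l' -> Q x y l -> Q x y l'.
  by move=> ll' Ql b b' Fb Fb' xb yb'; apply: Ql => //; exact: agree_le ll' _.
have [l lQ] : exists l, forall x y, Q x y l.
  apply: (@finitary_bound n (fun x l => forall y, Q x y l)).
  - by move=> x y l xy Ql z b b'; rewrite -(fg _ _ xy); exact: Ql.
  - by move=> x l l' ll' Ql y; exact: Q_le ll' _.
  move=> x; apply: (@finitary_bound n (fun y l => Q x y l)).
  - by move=> y z l yz Ql b b'; rewrite -(fg _ _ yz); exact: Ql.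
  - by move=> y l l' ll'; exact: Q_le ll'.
  move=> y.
  have [[V W] /= [nV nW] VWU] : nbhs (g x, g y) U.
    by apply: open_nbhs_nbhs; split=> //; exact: gU.
  have near z (N : set X) : nbhs z N -> exists m, forall b, F b ->
      agree m (code z) b -> N (phi b).1.
    move=> nN; have [Fz zE] := codeP z.
    have nN' : nbhs (phi (code z)) (fst @^-1` N) by apply: cvg_fst; rewrite zE.
    by have [m mN] := phi_continuous _ Fz _ nN'; exists m.
  have [m mV] := near _ _ nV; have [m' mW] := near _ _ nW.
  exists (maxn m m') => b b' Fb Fb' xb yb'; apply: VWU; split.
    by apply: mV => //; apply: agree_le xb; exact: leq_maxl.
  by apply: mW => //; apply: agree_le yb'; exact: leq_maxr.
exists (maxn n l); split; first exact: leq_maxl.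
by move=> x y; apply: (Q_le _ _ l) => //; exact: leq_maxr.
Qed.

Lemma continuous_homomorphism (U : nat -> set (X * X)) (Y : set X) :
  hausdorff_space X -> (forall x, exists y, ~ E x y) ->
  (forall n, open (U n)) -> (forall n x y, Y x -> Y y -> U n (x, y)) ->
  (forall K : set X, countable K ->
     exists2 y, Y y & forall p, K p -> ~ E p y) ->
  exists f : (nat -> bool) -> X,
    [/\ cylinder_continuous setT f, forall n x y, U n (f x, f y) &
        forall k x, ~ E (f (update k false x)) (f (update k true x))].
Proof.
move=> hX Enontrivial oU YU Ybig.
(* Points get codes from the complement of [E]: each is the first component of an inequivalent
   pair. *)
have /choice[code codeP] : forall x, exists c, F c /\ (phi c).1 = x.
  move=> x.
  have [y nE] := Enontrivial x.
  by have [c Fc phic] := (phi_range (x, y)).1 nE; exists c; rewrite phic.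
have /choice[wit witP] : forall p, exists c, ~ E p.1 p.2 -> F c /\ phi c = p.
  move=> p.
  have [/phi_range[c Fc phic]|Ep] := pselect (~ E p.1 p.2).
    by exists c.
  by exists (fun=> 0).
pose edge k (g : (nat -> bool) -> X) x :=
  (g (update k false x), g (update k true x)).
have edge_finitary n k g : finitary n g -> finitary n (edge k g).
  move=> fg x y xy; rewrite /edge.
  by congr (_, _); apply: fg => j jn; rewrite /update; case: (j == k) => //;
    exact: xy.
pose inv n (A : set ((nat -> bool) -> X)) := ~ covered E A /\
  forall g, A g -> [/\ forall x, Y (g x), finitary n g &
    forall k x, k < n -> ~ E (edge k g x).1 (edge k g x).2].
(* All members of [B] share initial segments of codes and witnesses, and the shared segments of
   codes are long enough to force membership in [U n]. *)
pose step n (A B : set ((nat -> bool) -> X)) :=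
  (forall g, B g -> exists g0 g1, [/\ A g0, A g1 & g = double n g0 g1]) /\
  exists l, [/\ n < l,
    forall g g' x, B g -> B g' -> agree l (code (g x)) (code (g' x)),
    forall g g' x k, B g -> B g' -> k < n.+1 ->
      agree n.+1 (wit (edge k g x)) (wit (edge k g' x)) &
    forall g x y b b', B g -> F b -> F b' ->
      agree l (code (g x)) b -> agree l (code (g y)) b' ->
      U n ((phi b).1, (phi b').1)].
have [||A [_ AP]] := @dependent_sequence _ inv step
    [set g | exists2 y, Y y & g = cst y].
- split.
    move=> [K cK KY]; have [y Yy nKy] := Ybig K cK.
    have [|p [x [Kp Epy]]] := KY (cst y); first by exists y.
    exact: nKy Epy.
  by move=> g [y Yy ->]; split.
- move=> n A [nA AP].
  have DP g : doubling E n A g -> [/\ forall x, Y (g x), finitary n.+1 g &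
      forall k x, k < n.+1 -> ~ E (edge k g x).1 (edge k g x).2].
    move=> [g0 [g1 [/AP[Y0 f0 E0] /AP[Y1 f1 E1] E01 ->]]]; split.
    - by move=> x; rewrite /double; case: (x n).
    - move=> x y xy; rewrite /double (xy n (ltnSn n)).
      by case: (y n); [apply: f1|apply: f0]; exact: agree_le (leqnSn _) _.
    - move=> k x; rewrite ltnS leq_eqVlt => /predU1P[->|kn] /=.
        by rewrite /double /update eqxx.
      rewrite /double {1 4}/update (gtn_eqF kn).
      by case: (x n); [apply: E1|apply: E0].
  have bound g : exists l, doubling E n A g -> n < l /\
      forall x y b b', F b -> F b' ->
      agree l (code (g x)) b -> agree l (code (g y)) b' ->
      U n ((phi b).1, (phi b').1).
    have [/DP[Yg fg _]|] := pselect (doubling E n A g); last by exists 0.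
    have [//|x y|l lP] := finitary_code_bound _ _ _ (U n) codeP fg;
      last by exists l.
    exact: YU.
  have [l lP] := choice bound.
  (* [q] records all that is to be fixed. Including [l g] gives one length common to all of [B]. *)
  pose q (g : (nat -> bool) -> X) (x : nat -> bool) :
      nat * seq nat * seq (seq nat) :=
    (l g, mkseq (code (g x)) (l g),
     mkseq (fun k => mkseq (wit (edge k g x)) n.+1) n.+1).
  have [||B [BD nB qB]] := @uncovered_fiber _ E _ n.+1 (doubling E n A) q.
  + move=> g /DP[_ fg _] x y xy; rewrite /q (fg _ _ xy); congr (_, _, _).
    by apply/agree_mkseq => k kn; rewrite (edge_finitary _ k _ fg _ _ xy).
  + by apply: uncovered_doubling nA => g /AP[].
  exists B; split; first by split=> // g /BD/DP.
  split; first by move=> g /BD[g0 [g1 [? ? _ ->]]]; exists g0, g1.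
  have [g0 Bg0] : exists g0, B g0.
    apply: contrapT => B0; apply: nB; exists set0 => // g Bg; exfalso.
    by apply: B0; exists g.
  have lE g : B g -> l g = l g0.
    by move=> Bg; have [] := qB _ _ (fun=> false) Bg Bg0.
  exists (l g0); split.
  + by have [] := lP _ (BD _ Bg0).
  + move=> g g' x Bg Bg'; have [_ + _] := qB _ _ x Bg Bg'.
    by rewrite !lE// => /agree_mkseq.
  + move=> g g' x k Bg Bg' kn; have /(congr1 snd)/agree_mkseq h :=
      qB _ _ x Bg Bg'.
    exact/agree_mkseq/h.
  + by move=> g x y b b' Bg; rewrite -(lE _ Bg);
      have [_] := lP _ (BD _ Bg); apply.
(* Undoing the doublings along the bits of [x] from [n] on restricts a member of [A m] to one of
   [A n], so what is fixed at stage [n] persists. *)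
have ancestor n m g x : n <= m -> A m g ->
    exists2 g', A n g' &
      forall z, (forall j, n <= j -> z j = x j) -> g z = g' z.
  move=> + + ; elim: m g => [|m IH] g.
    by rewrite leqn0 => /eqP-> Ag; exists g.
  rewrite leq_eqVlt => /predU1P[->|]; first by exists g.
  rewrite ltnS => nm; have [_ [+ _]] := AP m => /[apply] -[g0 [g1 [A0 A1 ->]]].
  have [g'' [Ag'' gg'']] : exists g'', A m g'' /\
      forall z, z m = x m -> double m g0 g1 z = g'' z.
    exists (if x m then g1 else g0); split; first by case: (x m).
    by move=> z; rewrite /double => ->; case: (x m).
  have [g' Ag' gg'] := IH g'' nm Ag''; exists g' => // z zx.
  by rewrite gg''; [exact: gg' | exact: zx].
have /choice[g gA] : forall n, exists g, A n g.
  move=> n; apply: contrapT => A0; have [[nA _] _] := AP n.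
  by apply: nA; exists set0 => // g Ag; exfalso; apply: A0; exists g.
have /choice[l lP] := fun n => (AP n).2.2.
have code_coherent n m x : n < m ->
    agree (l n) (code (g n.+1 x)) (code (g m x)).
  move=> nm; have [g' Ag' gg'] := ancestor n.+1 m (g m) x nm (gA m).
  by rewrite (gg' x)//; have [_ + _ _] := lP n; apply=> //; exact: gA.
have code_coherent' n x : agree n (code (g n x)) (code (g n.+1 x)).
  case: n => [//|n]; apply: agree_le (code_coherent n n.+2 x _) => //.
  by have [] := lP n.
have /choice[a aP] : forall x, exists a, forall n, agree n a (code (g n x)).
  by move=> x; apply: (agree_lim (fun n => n)) => // k; exact: leqnSn.
(* Stage [maxn n.+1 (l n)] is late enough for its code to share [l n] terms with [a x]. *)
have a_code n x : agree (l n) (a x) (code (g n.+1 x)).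
  have := code_coherent n (maxn n.+1 (l n)) x; rewrite leq_maxl => /(_ isT) h.
  apply: agree_trans (agree_sym h).
  by apply: agree_le (aP x _); exact: leq_maxr.
have Fa x : F (a x).
  by apply: F_closed => n; exists (code (g n x));
    [exact: (codeP _).1 | exact: aP].
exists (fun x => (phi (a x)).1); split.
- move=> x _ V nV.
  have nV' : nbhs (phi (a x)) (fst @^-1` V) by exact: cvg_fst nV.
  have [n nF] := phi_continuous _ (Fa x) _ nV'.
  exists n => y _ xy; apply: nF => //.
  have [[_ /(_ _ (gA n))[_ fg _]] _] := AP n.
  by apply: agree_trans (aP x n) _; rewrite (fg _ _ xy); exact/agree_sym.
- move=> n x y; have [_ _ _ +] := lP n.
  move=> /(_ _ x y _ _ (gA n.+1) (Fa x) (Fa y)).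
  by apply; apply: agree_sym; exact: a_code.
- move=> k x.
  pose w n := wit (edge k (g n) x).
  have w_coherent n m : k < n -> n <= m -> agree n (w n) (w m).
    move=> kn nm.
    have [g' Ag' gg'] := ancestor n m (g m) x nm (gA m).
    rewrite /w; have -> : edge k (g m) x = edge k g' x.
      have up b j : n <= j -> update k b x j = x j.
        by move=> nj; rewrite /update gtn_eqF //; exact: leq_trans nj.
      by rewrite /edge !gg'//; exact: up.
    case: n kn {nm gg'} Ag' => [//|n] kn Ag'.
    by have [_ _ + _] := lP n; apply=> //; exact: gA.
  (* The shift by [k.+1] skips the stages at which direction [k] does not exist yet. *)
  have [c cP] : exists c, forall j, agree (j + k.+1) c (w (j + k.+1)).
    apply: (agree_lim (fun j => j + k.+1) (fun j => w (j + k.+1))) => j.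
    - exact: leq_addr.
    - by rewrite addSn.
    - by apply: w_coherent; rewrite ?leq_addl ?addSn.
  pose fx b := (phi (a (update k b x))).1.
  suff [Fc cE] : F c /\ phi c = (fx false, fx true).
    by apply/(phi_range (fx false, fx true)); exists c.
  apply: coding_limit => //; first exact: hausdorff_prod.
  move=> V n [[V0 V1] /= [nV0 nV1] VV].
  have near b (N : set X) : nbhs (fx b) N ->
      exists m, forall i, m <= i -> N (g i (update k b x)).
    move=> nN.
    have nN' : nbhs (phi (a (update k b x))) (fst @^-1` N) by exact: cvg_fst nN.
    have [m mN] := phi_continuous _ (Fa _) _ nN'; exists m => i mi.
    rewrite -(codeP (g i _)).2; apply: mN; first exact: (codeP _).1.
    by apply: agree_le mi _; exact: aP.
  have [m0 m0V] := near _ _ nV0; have [m1 m1V] := near _ _ nV1.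
  (* At stage [m] the witness is close to [c], both values are close to their limits, and [k < m]
     makes the edge inequivalent. *)
  pose m := maxn n (maxn m0 m1) + k.+1.
  have [[_ /(_ _ (gA m))[_ _ nE]] _] := AP m.
  have [Fw wE] := witP _ (nE k x (leq_addl _ _)).
  exists (w m); split=> //.
    by apply: agree_le (cP _); rewrite (leq_trans _ (leq_addr _ _))// leq_maxl.
  rewrite /w wE; apply: VV; split=> /=.
    by apply: m0V; rewrite (leq_trans _ (leq_addr _ _))// !leq_max leqnn orbT.
  by apply: m1V; rewrite (leq_trans _ (leq_addr _ _))// !leq_max leqnn !orbT.
Qed.

End Homomorphism.

(** * A perfect set of inequivalent points *)

(** A finite fusion: the requirements in [L] are met one after the other, and once met they persist
    under [le]. *)
Lemma meet_requirements (T : Type) (J : eqType) (le : T -> T -> Prop)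
    (C Q : J -> T -> Prop) (L : seq J) (t : T) :
  (forall t, le t t) -> (forall t u v, le t u -> le u v -> le t v) ->
  (forall i t u, le t u -> C i t -> C i u) ->
  (forall i t u, le t u -> Q i t -> Q i u) ->
  (forall i t, C i t -> exists u, le t u /\ Q i u) ->
  (forall i, C i t) -> exists u, le t u /\ forall i, i \in L -> Q i u.
Proof.
move=> le_refl le_trans C_le Q_le dense Ct.
elim: L => [|i L [u [tu uL]]]; first by exists t.
have [v [uv Qv]] := dense i u (C_le _ _ _ tu (Ct i)).
exists v; split; first exact: le_trans uv.
by move=> j; rewrite inE => /predU1P[->//|/uL]; exact: Q_le uv.
Qed.

Section PerfectSet.
Context {X : topologicalType} (E : X -> X -> Prop).
Context (F : set (nat -> nat)) (phi : (nat -> nat) -> X * X).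
Context (f : (nat -> bool) -> X).

(** A pair of points of the Cantor space is one sequence of pairs of bits, so that the category
    lemmas apply to the product. *)
Definition witnessed n (w : nat -> nat) : set (nat -> bool * bool) :=
  [set z | exists c,
    [/\ F c, agree n w c & phi c = (f (fst \o z), f (snd \o z))]].

Definition zip_seq (x y : nat -> bool) : nat -> bool * bool :=
  fun k => (x k, y k).

Lemma agree_zip n x y x' y' :
  agree n x x' -> agree n y y' -> agree n (zip_seq x y) (zip_seq x' y').
Proof. by move=> xx yy k kn; rewrite /zip_seq xx ?yy. Qed.

Lemma heavy_witnessed_extend m n w l z :
  m <= n -> heavy (witnessed m w) l z ->
  exists w' l' z', [/\ agree m w w', l <= l', agree l z z' &
    heavy (witnessed n w') l' z'].
Proof.
move=> mn hP.
(* The clause on [w] does not involve [y]; a heavy piece, being nonempty, hands it over. *)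
pose P_ (s : seq nat) :=
  [set y | agree m w (nth 0 s) /\ witnessed n (nth 0 s) y].
have [|s [l' [z' [ll' zz' hs]]]] := @heavy_bigcup _ _ _ P_ _ _ hP.
  move=> y [c [Fc wc cy]]; exists (mkseq c n) => //.
  have cn : agree n (nth 0 (mkseq c n)) c by move=> k kn; rewrite nth_mkseq.
  split; last by exists c.
  apply: agree_trans wc _; apply: agree_le mn _; exact: agree_sym.
have [y _ [ws _]] := heavy_neq0 _ _ _ hs.
by exists (nth 0 s), l', z'; split=> //; apply: sub_heavy hs => u [].
Qed.

Context (E_equiv : Equivalence E).
Context (phi_range : forall p, ~ E p.1 p.2 <-> exists2 c, F c & phi c = p).
Context (f_edge :
  forall k x, ~ E (f (update k false x)) (f (update k true x))).

(* If the pairs with inequivalent images were meager near [z], then, flipping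
   a coordinate of the second component, some point would have its image
   equivalent to those of two points that differ at a single coordinate. *)
Lemma heavy_witnessed0 w l z : heavy (witnessed 0 w) l z.
Proof.
move=> m y _ _ mP.
pose t (p : bool * bool) := (p.1, ~~ p.2).
have tK : involutive t by move=> [a b]; rewrite /t /= negbK.
have [u yu nPu] :=
  Baire_cylinder _ m y (setU_meager _ _ mP (twist_meager t m _ tK mP)).
have EP v : agree m y v -> ~ (witnessed 0 w `&` cylinder m y) v ->
    E (f (fst \o v)) (f (snd \o v)).
  move=> yv nPv; apply: contrapT => /(phi_range (_, _))[c Fc cE].
  by apply: nPv; split=> //; exists c.
have yu' : agree m y (twist t m u).
  by apply: agree_trans yu _; exact: agree_twistl.
have E1 := EP _ yu (fun h => nPu (or_introl h)).
have E2 := EP _ yu' (fun h => nPu (or_intror h)).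
pose v b := update m b (snd \o u).
have v1 : snd \o u = v (u m).2.
  by apply/funext => k; rewrite /v /update; case: eqP => //= ->.
have v2 : snd \o twist t m u = v (~~ (u m).2).
  apply/funext => k; rewrite /v /update /twist /=.
  by case: eqP => //= ->.
have u1 : fst \o twist t m u = fst \o u.
  by apply/funext => k; rewrite /twist /=; case: ifP.
move: E1 E2; rewrite v1 v2 u1 => E1 E2.
have E12 : E (f (v (u m).2)) (f (v (~~ (u m).2))).
  by transitivity (f (fst \o u)) => //; symmetry.
move: E12; case: (u m).2 => /= E12; last exact: f_edge E12.
by apply: (f_edge m (snd \o u)); symmetry.
Qed.

(* At stage [n] the node of index [p] (a word of length [n], see [finitary]) is
   the cylinder of length [l] around [e p], and the first [n] terms of [w p q]
   are the prescribed initial segment of the witnesses for [p] and [q]. *)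
Let state : Type :=
  nat * ((nat -> bool) -> nat -> bool) *
  ((nat -> bool) -> (nat -> bool) -> nat -> nat).

Let scheme n (t : state) :=
  let: (l, e, w) := t in
  [/\ n <= l, finitary n e,
    forall p q p' q', agree n p p' -> agree n q q' -> w p q = w p' q' &
    forall p q, ~ agree n p q ->
      heavy (witnessed n (w p q)) l (zip_seq (e p) (e q))].

Let refines n (t t' : state) :=
  let: (l, e, w) := t in let: (l', e', w') := t' in
  [/\ l <= l', forall p, agree l (e p) (e' p) &
    forall p q, ~ agree n p q -> agree n (w p q) (w' p q)].

(** The finitely many pairs of words of length [n.+1] are treated in turn, each shrinking the nodes;
    the new witness segments are chosen afterwards. *)
Lemma scheme_step n t : scheme n t ->
  exists t', scheme n.+1 t' /\ refines n t t'.
Proof.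
case: t => -[l e] w [nl fS fw hS].
pose rep (s : n.+1.-tuple bool) : nat -> bool := nth false s.
(* The length of witness already prescribed: none for words that agree up to [n], which start from
   [heavy_witnessed0]. *)
pose lev (p q : nat -> bool) := if `[< agree n p q >] then 0 else n.
pose T : Type := nat * ((nat -> bool) -> nat -> bool).
pose le (t t' : T) := [/\ t.1 <= t'.1, forall p, agree t.1 (t.2 p) (t'.2 p) &
  finitary n.+1 t.2 -> finitary n.+1 t'.2].
pose J : eqType := (n.+1.-tuple bool * n.+1.-tuple bool)%type.
pose C (i : J) (t : T) := let: (p, q) := (rep i.1, rep i.2) in
  finitary n.+1 t.2 /\
  (~ agree n.+1 p q ->
    heavy (witnessed (lev p q) (w p q)) t.1 (zip_seq (t.2 p) (t.2 q))).
pose Q (i : J) (t : T) := let: (p, q) := (rep i.1, rep i.2) in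
  ~ agree n.+1 p q -> exists2 w', agree (lev p q) (w p q) w' &
     heavy (witnessed n.+1 w') t.1 (zip_seq (t.2 p) (t.2 q)).
have [||||||[l' e'] [[/= ll' SS' fS'] QS']] :=
    @meet_requirements T J le C Q
      (enum [set: n.+1.-tuple bool * n.+1.-tuple bool]%SET) (l, e).
- by move=> t; split.
- move=> t u v [tu1 tu2 tu3] [uv1 uv2 uv3]; split.
  + exact: leq_trans uv1.
  + by move=> p; apply: agree_trans (tu2 p) _; exact: agree_le (uv2 p).
  + by move=> /tu3/uv3.
- move=> [a b] t u [tu1 tu2 tu3] [ft Ct]; split; first exact: tu3.
  by move=> /Ct; apply: heavy_le => //; exact: agree_zip.
- move=> [a b] t u [tu1 tu2 tu3] Qt nab; have [w' ww' hw'] := Qt nab.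
  by exists w' => //; apply: heavy_le hw' => //; exact: agree_zip.
- move=> [a b] [k G]; rewrite /C /Q /=; move: (rep a) (rep b) => p q [fG hG].
  have [pq|npq] := pselect (agree n.+1 p q); first by exists (k, G); split.
  have lev_n : lev p q <= n.+1 by rewrite /lev; case: asboolP.
  (* The two halves of [z] become the new nodes of [p] and [q]; these words differ, so the updates
     do not clash. *)
  have [w' [k' [z [ww' kk' Gz hz]]]] :=
    heavy_witnessed_extend _ _ _ _ _ lev_n (hG npq).
  pose G' x := if `[< agree n.+1 p x >] then fst \o z
    else if `[< agree n.+1 q x >] then snd \o z else G x.
  have G'p : G' p = fst \o z by rewrite /G' asboolT.
  have G'q : G' q = snd \o z. by rewrite /G' asboolF ?asboolT.
  exists (k', G'); split; last first.
    move=> _; exists w' => //=; rewrite G'p G'q.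
    suff -> : zip_seq (fst \o z) (snd \o z) = z by [].
    by apply/funext => j; rewrite /zip_seq /=; case: (z j).
  split=> //=.
    move=> x; rewrite /G'; case: asboolP => [px|_].
      by rewrite -(fG _ _ px) => j jk /=; rewrite -Gz.
    by case: asboolP => [qx|//]; rewrite -(fG _ _ qx) => j jk /=; rewrite -Gz.
  move=> _ x y xy; rewrite /G' (fG _ _ xy).
  have same r : agree n.+1 r x <-> agree n.+1 r y.
    by split=> h; apply: agree_trans h _ => //; exact: agree_sym.
  by rewrite !(asbool_equiv_eq (same _)).
- move=> [a b]; split=> /=; first by move=> x y /(agree_le (leqnSn n))/fS.
  move=> _; rewrite /lev; case: asboolP => [_|nab];
    first exact: heavy_witnessed0.
  exact: hS.
have {}fS' : finitary n.+1 e'.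
  by apply: fS' => x y /(agree_le (leqnSn n))/fS.
have repP x : exists a, rep a = nth false (mkseq x n.+1).
  have sx : size (mkseq x n.+1) == n.+1 by rewrite size_mkseq.
  by exists (Tuple sx).
(* Choosing witnesses for the truncations [r p] and [r q] makes them depend on the first [n.+1] bits
   only. *)
pose r x : nat -> bool := nth false (mkseq x n.+1).
have rP x : agree n.+1 x (r x) by exact: agree_nth.
have agree_r p q : agree n.+1 (r p) (r q) <-> agree n.+1 p q.
  split=> pq.
    exact: agree_trans (agree_trans (rP p) pq) (agree_sym (rP q)).
  by apply: agree_trans (agree_trans (agree_sym (rP p)) pq) (rP q).
have /choice[w' w'P] : forall i : (nat -> bool) * (nat -> bool),
    exists w', ~ agree n.+1 (r i.1) (r i.2) ->
    agree (lev (r i.1) (r i.2)) (w (r i.1) (r i.2)) w' /\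
    heavy (witnessed n.+1 w') l' (zip_seq (e' (r i.1)) (e' (r i.2))).
  move=> [p q] /=; have [a ap] := repP p; have [b bq] := repP q.
  have := QS' (a, b); rewrite mem_enum inE => /(_ isT).
  rewrite /Q /= ap bq -/(r p) -/(r q).
  have [rpq _|nrpq /(_ nrpq)[w' ? ?]] := pselect (agree n.+1 (r p) (r q)).
    by exists (fun=> 0).
  by exists w'.
have w'P' p q := w'P (p, q).
have rE x y : agree n.+1 x y -> r x = r y.
  by move=> /agree_mkseq xy; rewrite /r xy.
have r_le x : agree n x (r x) by apply: agree_le (rP x).
exists (maxn l' n.+1, e', fun p q => w' (r p, r q)); split; split.
- exact: leq_maxr.
- exact: fS'.
- by move=> p q p' q' /rE-> /rE->.
- move=> p q npq; have [|_] := w'P' (r p) (r q); first by rewrite !agree_r.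
  rewrite /= -!(fS' _ _ (rP _)).
  by apply: heavy_le => //; exact: leq_maxl.
- by rewrite (leq_trans ll')// leq_maxl.
- exact: SS'.
- move=> p q npq.
  have rr x : r (r x) = r x by apply: rE; exact: agree_sym.
  have [|+ _] := w'P' (r p) (r q).
    by rewrite /= !agree_r => /(agree_le (leqnSn n)).
  rewrite /= !rr (fw _ _ p q); try exact: agree_sym.
  rewrite /lev; case: asboolP => [h|//].
  case: npq; apply: agree_trans (agree_trans (r_le p) h) _; exact: agree_sym.
Qed.

(** Once [p] and [q] have split, their witness segments converge to some [c]. Heavy sets are
    nonempty and so supply true witnesses near [c] for pairs near [(g p, g q)]; hence [c] witnesses
    the limit pair. *)
Lemma perfect_inequivalent :
  hausdorff_space X ->
  (forall c, (forall n, exists2 b, F b & agree n c b) -> F c) ->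
  cylinder_continuous F phi -> cylinder_continuous setT f ->
  exists g : (nat -> bool) -> nat -> bool,
    cylinder_continuous setT (f \o g) /\
    forall p q, p <> q -> ~ E (f (g p)) (f (g q)).
Proof.
move=> hX clF cphi cf.
have [||t [_ tP]] := @dependent_sequence _ scheme refines
    (0, fun=> fun=> false, fun=> fun=> fun=> 0).
  by split=> // p q n0; case: n0.
  exact: scheme_step.
pose l n := (t n).1.1; pose e n := (t n).1.2; pose w n := (t n).2.
have sch n : [/\ n <= l n, finitary n (e n) &
    forall p q, ~ agree n p q ->
      heavy (witnessed n (w n p q)) (l n) (zip_seq (e n p) (e n q))].
  by have [+ _] := tP n; rewrite /l /e /w; case: (t n) => -[? ?] ? [].
have ref n : [/\ l n <= l n.+1, forall p, agree (l n) (e n p) (e n.+1 p) &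
    forall p q, ~ agree n p q -> agree n (w n p q) (w n.+1 p q)].
  have [_] := tP n; rewrite /l /e /w.
  by case: (t n) => -[? ?] ?; case: (t n.+1) => -[? ?] ? [].
have /choice[g gP] : forall p, exists x, forall n, agree (l n) x (e n p).
  move=> p; apply: (agree_lim l (fun n => e n p)) => n;
    first by have [] := sch n.
    by have [] := ref n.
  by have [_ + _] := ref n; apply.
exists g; split.
  move=> p _ V /(cf (g p) I)[n nV]; exists n => q _ pq; apply: nV => //.
  have [nl fS _] := sch n.
  apply: agree_trans (agree_le nl (gP p n)) _.
  by rewrite (fS _ _ pq); apply: agree_sym; exact: agree_le nl (gP q n).
move=> p q pq.
have [k npq] : exists k, ~ agree k p q.
  apply: contrapT => nk; apply: pq; apply/funext => j.
  by apply: contrapT => pqj; apply: nk; exists j.+1 => /(_ j (ltnSn j)).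
have npq_le j : ~ agree (j + k) p q.
  by move=> h; apply: npq; apply: agree_le h; exact: leq_addl.
have [c cP] : exists c, forall j, agree (j + k) c (w (j + k) p q).
  apply: (agree_lim (fun j => j + k) (fun j => w (j + k) p q)) => j.
  - exact: leq_addr.
  - by rewrite leq_add2r.
  - by have [_ _] := ref (j + k); rewrite addSn; exact.
suff [Fc cE] : F c /\ phi c = (f (g p), f (g q)).
  by apply/(phi_range (_, _)); exists c.
apply: coding_limit => //; first exact: hausdorff_prod.
move=> V n [[V0 V1] /= [nV0 nV1] VV].
have [m0 m0V] := cf _ I _ nV0; have [m1 m1V] := cf _ I _ nV1.
pose m := maxn n (maxn m0 m1) + k.
have le_m i : i <= maxn n (maxn m0 m1) -> i <= m.
  by move=> im; rewrite (leq_trans im)// leq_addr.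
have [ml _ hm] := sch m.
have [z zm [b [Fb wb bz]]] := heavy_neq0 _ _ _ (hm _ _ (npq_le _)).
exists b; split=> //.
  apply: agree_trans (_ : agree n c (w m p q)) _.
    by apply: agree_le (cP _); apply: le_m; exact: leq_maxl.
  by apply: agree_le wb; apply: le_m; exact: leq_maxl.
rewrite bz; apply: VV; split=> /=.
  apply: m0V => // j jm.
  have jl : j < l m by rewrite (leq_trans jm)// (leq_trans _ ml)// le_m//
    !leq_max leqnn orbT.
  by rewrite (gP p m j jl) /= -(zm _ jl).
apply: m1V => // j jm.
have jl : j < l m by rewrite (leq_trans jm)// (leq_trans _ ml)// le_m//
  !leq_max leqnn !orbT.
by rewrite (gP q m j jl) /= -(zm _ jl).
Qed.

End PerfectSet.

Theorem theorem2p3 (X : topologicalType) (E R : X -> X -> Prop)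
  (X_hausdorff : hausdorff_space X)
  (E_equiv : Equivalence E)
  (E_coanalytic : co_analytic (rel_set E))
  (R_refl : Reflexive R)
  (R_Gdelta : Gdelta (rel_set R))
  (Y : set X)
  (Y_clique : clique R Y)
  (Y_uncountable : ~ countable (classes_meeting E Y)) :
  exists C : set X, [/\ Cantor_set C, partial_transversal E C & clique R C].
Proof.
have Ybig (K : set X) : countable K ->
    exists2 y, Y y & forall p, K p -> ~ E p y.
  move=> cK; apply: contrapT => nY; apply: Y_uncountable.
  (* If each point of [Y] were equivalent to a point of [K], every class meeting [Y] would be the
     class of a point of [K]. *)
  apply: (@sub_countable _ _ _ ((fun x => [set y | E x y]) @` K)).
    apply: subset_card_le => _ [[x _ <-] [y [/= Exy Yy]]].
    apply: contrapT => nK; apply: nY; exists y => // p Kp Epy; apply: nK.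
    exists p => //; apply/seteqP; split=> z /= h; transitivity y => //.
      by transitivity p => //; symmetry.
    by transitivity x => //; symmetry.
  exact: sub_countable (card_image_le _ _) cK.
have [x0 _ _] := Ybig set0 (countable0 _).
have nontrivial x : exists y, ~ E x y.
  by have [y _ /(_ x erefl)] := Ybig [set x] (countable1 x); exists y.
have [F [phi [clF cphi rphi]]] := co_analytic_coding E x0 E_coanalytic.
have [U oU RU] := R_Gdelta.
have RE x y : R x y <-> forall n, U n (x, y).
  have -> : R x y = rel_set R (x, y) by [].
  by rewrite RU; split=> [h n|h n _]; [exact: h|exact: h].
have YU n x y : Y x -> Y y -> U n (x, y).
  move=> Yx Yy; apply: (RE x y).1.
  by have [->|xy] := pselect (x = y); [exact: R_refl|exact: Y_clique].
have [f [cf fU fE]] :=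
  continuous_homomorphism E F phi clF cphi rphi U Y X_hausdorff nontrivial oU
    YU Ybig.
have [g [cg gE]] := perfect_inequivalent E F phi f E_equiv rphi fE X_hausdorff
  clF cphi cf.
exists (range (f \o g)); split.
(* Injectivity: distinct branches have inequivalent images, while equal images are equivalent. *)
- apply: cylinder_continuous_Cantor_set => // p q fpq.
  apply: contrapT => /gE; apply; rewrite -[f (g p)]/((f \o g) p) fpq.
  reflexivity.
- by move=> _ _ [p _ <-] [q _ <-] fpq; apply: gE => pq; apply: fpq; rewrite pq.
- by move=> _ _ [p _ <-] [q _ <-] _; apply/RE => n; exact: fU.
Qed.
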